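(* Let $K$ be a monoid with submonoids $G$ and $H$ such that $K=G\bowtie H$, and suppose that $G$ and $H$ are Garside monoids. Then $K$ is a Garside monoid.
   Context: Zappa–Szép product: for a monoid $K$ with submonoids $G,H$, write $K=G\bowtie H$ if for every $k\in K$ there exist unique $g_1,g_2\in G$ and $h_1,h_2\in H$ such that $g_1h_1=k=h_2g_2$. Garside monoids: in a monoid $M$ with identity $\mathbf 1$, write $x\preccurlyeq y$ ($x$ is a prefix of $y$) if $y=xu$ for some $u\in M$, and $y\succcurlyeq x$ ($x$ is a suffix of $y$) if $y=ux$ for some $u\in M$. An atom is an element $a\neq\mathbf 1$ such that $a=uv$ implies $u=\mathbf 1$ or $v=\mathbf 1$. $M$ is atomic if it is generated by its atoms and for each $x\in M$ there is an upper bound on the lengths of decompositions of $x$ as a product of atoms. An element is balanced if its set of prefixes equals its set of suffixes; this common set is denoted $\mathrm{Div}(d)$. A Garside structure is a pair $(M,\Delta)$ where $M$ is a cancellative atomic monoid, the prefix and suffix relations are lattice orders, $\Delta\in M$ is balanced, $M$ is generated by $\mathrm{Div}(\Delta)$, and $\mathrm{Div}(\Delta)$ is finite. $M$ is a Garside monoid if such a $\Delta$ exists. *)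

(* Defs.v *)
From mathcomp Require Import all_boot.
From mathcomp Require Import classical_sets cardinality.
From Stdlib Require Relation_Definitions.

Set Implicit Arguments.
Unset Strict Implicit.
Unset Printing Implicit Defensive.

Local Open Scope classical_set_scope.
Local Open Scope group_scope.

Section Garside.
Variable M : monoidType.
Implicit Types (x y a d : M) (s : seq M) (S : set M).

Definition prefix_of x y : Prop := exists u, y = x * u.
Definition suffix_of x y : Prop := exists u, y = u * x.

Definition atom a : Prop :=
  a <> 1 /\ forall u v, a = u * v -> u = 1 \/ v = 1.

(* [decomposition S s x]: the word [s] in letters from [S] has product [x];
   the empty word is the decomposition of 1. *)
Definition decomposition S s x : Prop :=
  (forall a, a \in s -> S a) /\ \prod_(a <- s) a = x.

Definition generated_by S : Prop := forall x, exists s, decomposition S s x.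

Definition atomic : Prop :=
  generated_by [set a | atom a] /\
  forall x, exists n : nat, forall s,
    decomposition [set a | atom a] s x -> (size s <= n)%N.

Definition cancellative : Prop :=
  right_injective (@mul M) /\ left_injective (@mul M).

Definition balanced d : Prop :=
  [set x | prefix_of x d] = [set x | suffix_of x d].

(* Equally the set of suffixes of [d] when [d] is balanced. *)
Definition Div d : set M := [set x | prefix_of x d].

Definition lattice_order (le : M -> M -> Prop) : Prop :=
  [/\ Relation_Definitions.order M le,
      forall x y, exists z,
        [/\ le x z, le y z & forall t, le x t -> le y t -> le z t]
    & forall x y, exists z,
        [/\ le z x, le z y & forall t, le t x -> le t y -> le t z]].

Definition garside_structure d : Prop :=
  [/\ cancellative /\ atomic,
      lattice_order prefix_of /\ lattice_order suffix_of,
      balanced d,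
      generated_by (Div d)
    & finite_set (Div d)].

End Garside.

Definition garside_monoid (M : monoidType) : Prop :=
  exists d : M, garside_structure d.

(* A submonoid of [K] is a [subMonoidType]: a monoid [G] whose injection
   [\val : G -> K] is a morphism onto the elements satisfying [PG]. *)
Definition zappa_szep (K : monoidType) (PG PH : pred K)
    (G : subMonoidType PG) (H : subMonoidType PH) : Prop :=
  forall k : K, exists! x : G * G * H * H,
    let: (g1, g2, h1, h2) := x in
    \val g1 * \val h1 = k /\ k = \val h2 * \val g2.

(* Main.v *)
(** Let [A], [B] be the images of [G], [H] in [K]. Moving a factor of [A]
    across one of [B] preserves the maximal number of nontrivial factors,
    which gives a length on [K]. If [h g1] and [h g2] have the same [A]-part
    [c], then a lcm of their [B]-parts shows that [h (g1 v g2)] has [A]-part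
    dividing [c], so [g1 = g2] by length; hence [h] permutes the finitely many
    atoms of [A], acts bijectively on [A], and [K] inherits lcms from [A] and
    [B].

    Let [d] be a Garside element of [A] of minimal length. The gcd of the
    ideal [K d K] is again a Garside element of [A], hence is [d], so [K d] is
    contained in [d K]; by duality [d K = K d]. The product of two such
    elements, one for [A] and one for [B], is a Garside element of [K]. *)
From HB Require Import structures.
Require Import Defs.
From mathcomp Require Import all_boot.
From mathcomp Require Import boolp classical_sets cardinality.
From mathcomp Require Import zify.
From Stdlib Require Relation_Definitions.

Set Implicit Arguments.
Unset Strict Implicit.
Unset Printing Implicit Defensive.

Local Open Scope classical_set_scope.
Local Open Scope group_scope.

(** * Extremal integers, finite relations, the opposite monoid and divisibility *)

Lemma ex_max_nat (P : nat -> Prop) N :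
  (exists n, P n) -> (forall n, P n -> (n <= N)%N) ->
  exists2 n, P n & forall m, P m -> (m <= n)%N.
Proof.
move=> [n0 Pn0] ubP.
have exP : exists n, `[< P n >] by exists n0; apply/asboolP.
have ubP' n : `[< P n >] -> (n <= N)%N by move/asboolP/ubP.
case: (ex_maxnP exP ubP') => n /asboolP Pn maxn.
by exists n => // m Pm; apply: maxn; apply/asboolP.
Qed.

Lemma ex_min_nat (P : nat -> Prop) :
  (exists n, P n) -> exists2 n, P n & forall m, P m -> (n <= m)%N.
Proof.
move=> [n0 Pn0]; have exP : exists n, `[< P n >] by exists n0; apply/asboolP.
case: (ex_minnP exP) => n /asboolP Pn minn.
by exists n => // m Pm; apply: minn; apply/asboolP.
Qed.

(** Choice turns [r] into an injective self-map of a finite set. The relational form suits maps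
    known only through existence, such as the action on atoms. *)
Lemma finite_inj_surj (T : choiceType) (S : set T) (r : T -> T -> Prop) :
  finite_set S ->
  (forall x, S x -> exists2 y, S y & r x y) ->
  (forall x x' y, S x -> S x' -> S y -> r x y -> r x' y -> x = x') ->
  forall y, S y -> exists2 x, S x & r x y.
Proof.
move=> /finite_seqP[s0 defS] tot inj y Sy.
pose s := undup s0.
have memS x : S x <-> x \in s by rewrite defS mem_undup.
have /choice[f fP] x : exists y, S x -> S y /\ r x y.
  case: (lem (S x)) => [Sx|nSx]; last by exists x.
  by have [z Sz rxz] := tot x Sx; exists z.
have uniq_fs : uniq (map f s).
  rewrite map_inj_in_uniq ?undup_uniq // => x x' /memS Sx /memS Sx' eqf.
  have [Sfx rx] := fP x Sx; have [_ rx'] := fP x' Sx'.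
  by apply: (inj x x' (f x)); rewrite // {1}eqf.
have sub_fs : {subset map f s <= s}.
  by move=> _ /mapP[x /memS Sx ->]; apply/memS; case: (fP x Sx).
have [_ eq_fs] := uniq_min_size uniq_fs sub_fs (eq_leq (esym (size_map f s))).
have /mapP[x /memS Sx ->] : y \in map f s by rewrite eq_fs; apply/memS.
by exists x => //; case: (fP x Sx).
Qed.

(** The opposite monoid on the same carrier: its [prefix_of] unfolds to [suffix_of] in [M], so
    one-sided results yield their mirror images. *)
Definition converse (M : monoidType) : Type := M.

HB.instance Definition _ (M : monoidType) := Choice.on (converse M).

Lemma converse_mulA (M : monoidType) :
  associative (fun x y : converse M => (y : M) * (x : M) : converse M).
Proof. by move=> x y z; rewrite -mulgA. Qed.

HB.instance Definition _ (M : monoidType) :=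
  isMonoid.Build (converse M) (@converse_mulA M) (@mulg1 M) (@mul1g M).

Definition is_lcm (M : monoidType) (le : M -> M -> Prop) (x y z : M) : Prop :=
  [/\ le x z, le y z & forall t, le x t -> le y t -> le z t].

Lemma prefix_of_refl (M : monoidType) (x : M) : prefix_of x x.
Proof. by exists 1; rewrite mulg1. Qed.

Lemma prefix_of_mulr (M : monoidType) (x y : M) : prefix_of x (x * y).
Proof. by exists y. Qed.

Lemma prefix_of_trans (M : monoidType) (x y z : M) :
  prefix_of x y -> prefix_of y z -> prefix_of x z.
Proof. by move=> [u ->] [v ->]; exists (u * v); rewrite mulgA. Qed.

Lemma atom_converse (M : monoidType) (a : M) :
  @atom (converse M) a <-> atom a.
Proof. by split=> -[a1 aP]; split=> // u v /aP[]; [right|left|right|left]. Qed.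

Lemma atom_generator (M : monoidType) (S : set M) (a : M) :
  generated_by S -> atom a -> S a.
Proof.
move=> genS [a1 aP]; have [s [sS prods]] := genS a.
elim: s sS prods => [|x s IHs] sS; first by rewrite big_nil => /esym/a1.
rewrite big_cons => eqa; case: (aP x _ (esym eqa)) => eq1.
  by apply: IHs; [move=> y ys; apply: sS; rewrite inE ys orbT
                 |rewrite -eqa eq1 mul1g].
by rewrite eq1 mulg1 in eqa; rewrite -eqa; apply: sS; rewrite inE eqxx.
Qed.

(** * Monoids with a superadditive length: atoms, atomicity, gcds from lcms *)

Section Length.
Variables (M : monoidType) (l : M -> nat).
Hypothesis lenM : forall x y, (l x + l y <= l (x * y))%N.
Hypothesis len0 : forall x, l x = 0%N -> x = 1.
Implicit Types x y z a t : M.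

Lemma len1 : l 1 = 0%N.
Proof. by have := lenM 1 1; rewrite mulg1; lia. Qed.

Lemma prefix_order : Relation_Definitions.order M (@prefix_of M).
Proof.
split=> [x|x y z|x y]; first exact: prefix_of_refl.
  exact: prefix_of_trans.
move=> [u defy] [v defx]; have := lenM x u; have := lenM y v.
rewrite -defx -defy => lx ly.
have /len0 u1 : l u = 0%N by lia.
by rewrite defy u1 mulg1.
Qed.

Lemma prefix_len_eq x y : prefix_of x y -> (l y <= l x)%N -> x = y.
Proof.
move=> [u ->] le_l; have := lenM x u => lxu.
have /len0 -> : l u = 0%N by lia.
by rewrite mulg1.
Qed.

Lemma atom_ind (P : M -> Prop) :
  P 1 -> (forall a x, atom a -> P x -> P (a * x)) -> forall x, P x.
Proof.
(* Strengthened to [P y -> P (x * y)], so that a splitting [x = u * v] into shorter factors is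
   absorbed one factor at a time. *)
move=> P1 PM x; rewrite -(mulg1 x); move: {1}x (1) P1 => {}x y Py.
have [n ltx] := ubnP (l x); elim: n => // n IHn in x ltx y Py *.
case: (lem (x = 1)) => [->|x1]; first by rewrite mul1g.
case: (lem (atom x)) => [ax|nax]; first exact: PM.
have [u [v [defx u1 v1]]] : exists u v, [/\ x = u * v, u <> 1 & v <> 1].
  apply: contrapT => noex; apply: nax; split=> // u v defx.
  case: (lem (u = 1)); first by left.
  case: (lem (v = 1)); first by right.
  by move=> v1 u1; case: noex; exists u, v.
have lu : l u <> 0%N by move=> /len0.
have lv : l v <> 0%N by move=> /len0.
have luv := lenM u v; rewrite -defx in luv.
have Pvy : P (v * y) by apply: IHn => //; lia.
by rewrite defx -mulgA; apply: IHn => //; lia.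
Qed.

Lemma len_atomic : atomic M.
Proof.
split=> [|x].
  apply: atom_ind => [|a x ax [s [sA prods]]].
    by exists [::]; rewrite /decomposition big_nil.
  exists (a :: s); split; last by rewrite big_cons prods.
  by move=> b; rewrite inE => /orP[/eqP->|/sA].
exists (l x) => s []; elim: s x => //= a s IHs x sA.
rewrite big_cons => <-; apply: leq_trans (lenM _ _).
have : l a <> 0%N.
  by move=> /len0 a1; have [] := sA a (mem_head _ _).
have := IHs _ (fun b bs => sA b (mem_behead (s := a :: s) bs)) erefl.
by lia.
Qed.

Hypothesis lcm_ex : forall x y, exists z, is_lcm (@prefix_of M) x y z.

(** A common divisor of maximal length works: its lcm with any other common divisor is again a
    common divisor, hence not longer. [X] may be infinite, as is the ideal to which this is
    applied. *)
Lemma gcd_ex (X : set M) x0 : X x0 ->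
  exists2 z, (forall x, X x -> prefix_of z x) &
    forall t, (forall x, X x -> prefix_of t x) -> prefix_of t z.
Proof.
move=> Xx0; pose common t := forall x, X x -> prefix_of t x.
have ex : exists n, exists2 t, common t & l t = n.
  by exists (l 1), 1 => // x _; exists x; rewrite mul1g.
have bound n : (exists2 t, common t & l t = n) -> (n <= l x0)%N.
  by move=> [t /(_ x0 Xx0)[u ->] <-]; have := lenM t u; lia.
have [_ [z cz <-] maxz] := ex_max_nat ex bound.
exists z => // t ct; have [m [zm tm minm]] := lcm_ex z t.
have -> // : z = m.
apply: prefix_len_eq => //; apply: maxz; exists m => // x Xx.
by apply: minm; [apply: cz | apply: ct].
Qed.

Lemma prefix_lattice : lattice_order (@prefix_of M).
Proof.
split=> [||x y]; [exact: prefix_order | exact: lcm_ex |].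
have [|z zP maxz] := @gcd_ex [set t | t = x \/ t = y] x; first by left.
exists z; split; [by apply: zP; left | by apply: zP; right |].
by move=> t tx ty; apply: maxz => w [] ->.
Qed.

End Length.

(** * Zappa-Szép decompositions by subsets, and Garside elements of a factor *)

Record szep (M : monoidType) (A B : set M) : Prop := Szep {
  szep_1l : A 1;
  szep_1r : B 1;
  szep_Ml : forall x y, A x -> A y -> A (x * y);
  szep_Mr : forall x y, B x -> B y -> B (x * y);
  szep_lr : forall k, exists a b, [/\ A a, B b & k = a * b];
  szep_rl : forall k, exists b a, [/\ B b, A a & k = b * a];
  szep_inj_lr : forall a b a' b', A a -> B b -> A a' -> B b' ->
    a * b = a' * b' -> a = a' /\ b = b';
  szep_inj_rl : forall b a b' a', B b -> A a -> B b' -> A a' ->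
    b * a = b' * a' -> b = b' /\ a = a';
  szep_unitl : forall x y, A x -> A y -> x * y = 1 -> x = 1;
  szep_unitr : forall x y, B x -> B y -> x * y = 1 -> x = 1 }.

Lemma szep_sym (M : monoidType) (A B : set M) : szep A B -> szep B A.
Proof. by case=> *; split. Qed.

Lemma szep_converse (M : monoidType) (A B : set M) :
  szep A B -> @szep (converse M) A B.
Proof.
case=> A1 B1 AM BM lr rl injlr injrl uA uB; split=> //.
- by move=> x y Ax Ay; apply: AM.
- by move=> x y Bx By; apply: BM.
- by move=> k; have [b [a [Bb Aa ->]]] := rl k; exists a, b.
- by move=> k; have [a [b [Aa Bb ->]]] := lr k; exists b, a.
- by move=> a b a' b' Aa Bb Aa' Bb' /injrl[].
- by move=> b a b' a' Bb Aa Bb' Aa' /injlr[].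
- move=> x y Ax Ay yx1; have yxM : (y : M) * (x : M) = 1 := yx1.
  by have y1 := uA y x Ay Ax yxM; rewrite y1 mul1g in yxM.
- move=> x y Bx By yx1; have yxM : (y : M) * (x : M) = 1 := yx1.
  by have y1 := uB y x By Bx yxM; rewrite y1 mul1g in yxM.
Qed.

(** If [b] is the [B]-part of [x], uniqueness puts [b * y] in [A]; comparing decompositions with [B]
    first then makes [b] invertible in [B], hence trivial. *)
Lemma szep_factor (M : monoidType) (A B : set M) (Z : szep A B) (x y : M) :
  A (x * y) -> A x /\ A y.
Proof.
move=> Axy; have [a [b [Aa Bb defx]]] := szep_lr Z x.
have [a' [b' [Aa' Bb' defby]]] := szep_lr Z (b * y).
have [eqa b'1] : a * a' = x * y /\ b' = 1.
  apply: (szep_inj_lr Z) => //; [exact: (szep_Ml Z) | exact: (szep_1r Z) |].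
  by rewrite mulg1 -mulgA -defby defx mulgA.
rewrite b'1 mulg1 in defby.
have [b2 [a2 [Bb2 Aa2 defy]]] := szep_rl Z y.
have [bb2 _] : b * b2 = 1 /\ a2 = a'.
  apply: (szep_inj_rl Z) => //; [exact: (szep_Mr Z) | exact: (szep_1r Z) |].
  by rewrite mul1g -mulgA -defy.
have b1 := szep_unitr Z Bb Bb2 bb2.
by rewrite defx -(mul1g y) -b1 defby b1 mulg1.
Qed.

Lemma szep_prefix (M : monoidType) (A B : set M) (Z : szep A B) (x y : M) :
  A y -> prefix_of x y -> A x.
Proof. by move=> Ay [u defy]; rewrite defy in Ay; case: (szep_factor Z Ay). Qed.

(* [gar A d]: [d] is a Garside element of the factor-closed submonoid [A];
   prefixes and atoms of [A] may be taken in the whole monoid. *)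
Record gar (M : monoidType) (A : set M) (d : M) : Prop := Gar {
  gar_in : A d;
  gar_balanced : forall x, prefix_of x d <-> suffix_of x d;
  gar_fin : finite_set (Div d);
  gar_atom : forall a, A a -> atom a -> prefix_of a d }.

Lemma gar_converse (M : monoidType) (A : set M) (d : M) :
  @gar (converse M) A d <-> gar A d.
Proof.
split=> -[Ad bal fin atm]; split=> //.
- by move=> x; split=> /bal.
- by apply: sub_finite_set fin => x /bal.
- by move=> a Aa /atom_converse/(atm a Aa)/bal.
- by move=> x; split=> /bal.
- by apply: sub_finite_set fin => x /bal.
- by move=> a Aa /atom_converse/(atm a Aa)/bal.
Qed.

(** The data of the main argument, closed under exchanging the factors and under [converse], so that
    each result is proved for one factor and one side only. *)
Record garside_szep (M : monoidType) (A B : set M) (l : M -> nat) : Prop :=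
  GarsideSzep {
  gs_szep : szep A B;
  gs_mulI : right_injective (@mul M);
  gs_mulIm : left_injective (@mul M);
  gs_lenM : forall x y, (l x + l y <= l (x * y)%g)%N;
  gs_len0 : forall x, l x = 0%N -> x = 1;
  gs_lenl : forall a b a' b', A a -> B b -> A a' -> B b' ->
    a * b = b' * a' -> l a = l a';
  gs_lenr : forall a b a' b', A a -> B b -> A a' -> B b' ->
    a * b = b' * a' -> l b = l b';
  gs_lcml : forall x y, A x -> A y ->
    exists2 z, A z & is_lcm (@prefix_of M) x y z;
  gs_lcmr : forall x y, B x -> B y ->
    exists2 z, B z & is_lcm (@prefix_of M) x y z;
  gs_slcml : forall x y, A x -> A y ->
    exists2 z, A z & is_lcm (@suffix_of M) x y z;
  gs_slcmr : forall x y, B x -> B y ->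
    exists2 z, B z & is_lcm (@suffix_of M) x y z;
  gs_garl : exists d, gar A d;
  gs_garr : exists d, gar B d }.

Lemma gs_sym (M : monoidType) (A B : set M) l :
  garside_szep A B l -> garside_szep B A l.
Proof.
case=> S *; split=> //; first exact: szep_sym.
- by move=> b a b' a' Bb Aa Bb' Aa' eq; symmetry; eauto.
- by move=> b a b' a' Bb Aa Bb' Aa' eq; symmetry; eauto.
Qed.

Lemma gs_converse (M : monoidType) (A B : set M) l :
  garside_szep A B l -> @garside_szep (converse M) A B l.
Proof.
case=> S mI mIm lM l0 ll lr lcml lcmr slcml slcmr [dA gA] [dB gB]; split=> //.
- exact: szep_converse.
- by move=> x y; rewrite addnC; apply: (lM y x).
- move=> a b a' b' Aa Bb Aa' Bb' eq.
  by rewrite (ll a' b' a b Aa' Bb' Aa Bb (esym eq)).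
- move=> a b a' b' Aa Bb Aa' Bb' eq.
  by rewrite (lr a' b' a b Aa' Bb' Aa Bb (esym eq)).
- by exists dA; apply/gar_converse.
- by exists dB; apply/gar_converse.
Qed.

(** * The action of one factor on the other *)

Section GarsideSzep.
Variables (M : monoidType) (l : M -> nat).
Implicit Types (A B : set M).

(** Moving across [B] preserves length, so [g1], [g2] and [c] have equal length; the image of the
    lcm [m] divides [c], so [m] is no longer than [g1] or [g2] and equals both. *)
Lemma szep_act_inj A B (Z : garside_szep A B l) g1 g2 c h h1 h2 :
  A g1 -> A g2 -> A c -> B h -> B h1 -> B h2 ->
  h * g1 = c * h1 -> h * g2 = c * h2 -> g1 = g2.
Proof.
move=> Ag1 Ag2 Ac Bh Bh1 Bh2 eq1 eq2; have S := gs_szep Z.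
have [m Am [g1m g2m minm]] := gs_lcml Z Ag1 Ag2.
(* Completing [h1] and [h2] to [p] makes both [h * g1 * s1] and [h * g2 * s2] equal to [c * p];
   cancelling [h] gives a common multiple of [g1] and [g2]. *)
have [p Bp [[s1 h1p] [s2 h2p] _]] := gs_lcmr Z Bh1 Bh2.
have eq_s : g1 * s1 = g2 * s2.
  by apply: (gs_mulI Z (y := h)); rewrite !mulgA eq1 eq2 -!mulgA -h1p -h2p.
have [r defr] : prefix_of m (g1 * s1).
  by apply: minm; [exists s1 | exists s2].
have [m' [h' [Am' Bh' eqm]]] := szep_lr S (h * m).
have [c1 [k1 [Ac1 Bk1 eqr]]] := szep_lr S (h' * r).
have [eqc _] : c = m' * c1 /\ p = k1.
  apply: (szep_inj_lr S) => //; first exact: (szep_Ml S).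
  by rewrite h1p mulgA -eq1 -!mulgA -eqr defr !mulgA eqm.
have lenm : (l m <= l c)%N.
  rewrite eqc -(gs_lenl Z Am' Bh' Am Bh (esym eqm)).
  by have := gs_lenM Z m' c1; lia.
have eq_l1 := gs_lenl Z Ac Bh1 Ag1 Bh (esym eq1).
have eq_l2 := gs_lenl Z Ac Bh2 Ag2 Bh (esym eq2).
have lM := gs_lenM Z; have l0 := gs_len0 Z.
rewrite (prefix_len_eq lM l0 g1m) -?eq_l1 //.
by rewrite (prefix_len_eq lM l0 g2m) -?eq_l2.
Qed.

(** A factorization of [c] pulls back across [B] to one of [a] with factors of the same lengths, so
    a trivial factor comes from a trivial one. *)
Lemma szep_act_atom A B (Z : garside_szep A B l) a h c h' :
  A a -> atom a -> B h -> A c -> B h' -> h * a = c * h' -> atom c.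
Proof.
move=> Aa [a1 aP] Bh Ac Bh' eq; have S := gs_szep Z.
have l1 := len1 (gs_lenM Z).
split=> [c1|u v defc].
  by apply/a1/(gs_len0 Z); rewrite -(gs_lenl Z Ac Bh' Aa Bh (esym eq)) c1.
have [Au Av] : A u /\ A v by apply: (szep_factor S); rewrite -defc.
have [h1 [v' [Bh1 Av' eqv]]] := szep_rl S (v * h').
have [h2 [u' [Bh2 Au' equ]]] := szep_rl S (u * h1).
have [_ /esym/aP[]] : h2 = h /\ u' * v' = a.
  apply: (szep_inj_rl S) => //; first exact: (szep_Ml S).
  by rewrite mulgA -equ eq defc -!mulgA eqv.
- move=> u1; left; apply: (gs_len0 Z).
  by rewrite (gs_lenl Z Au Bh1 Au' Bh2 equ) u1.
- move=> v1; right; apply: (gs_len0 Z).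
  by rewrite (gs_lenl Z Av Bh' Av' Bh1 eqv) v1.
Qed.

(** The atoms of [A] divide a Garside element, so they are finitely many, and the injective action
    of [h] permutes them. *)
Lemma szep_act_atom_surj A B (Z : garside_szep A B l) a h :
  A a -> atom a -> B h ->
  exists b h', [/\ A b, atom b, B h' & h * b = a * h'].
Proof.
move=> Aa ata Bh; have S := gs_szep Z.
pose r x y := exists2 h', B h' & h * x = y * h'.
have fin : finite_set [set x | A x /\ atom x].
  have [d [_ _ find dP]] := gs_garl Z.
  by apply: sub_finite_set find => x [Ax /dP]; apply.
have tot x : A x /\ atom x -> exists2 y, A y /\ atom y & r x y.
  move=> [Ax atx]; have [c [h' [Ac Bh' eq]]] := szep_lr S (h * x).
  by exists c; [split=> //; apply: (szep_act_atom Z) eq | exists h'].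
have inj x x' y : A x /\ atom x -> A x' /\ atom x' -> A y /\ atom y ->
    r x y -> r x' y -> x = x'.
  move=> [Ax _] [Ax' _] [Ay _] [h1 Bh1 eq1] [h2 Bh2 eq2].
  exact: (szep_act_inj Z Ax Ax' Ay Bh Bh1 Bh2 eq1 eq2).
have [b [Ab atb] [h' Bh' eq]] := finite_inj_surj fin tot inj (conj Aa ata).
by exists b, h'.
Qed.

Lemma szep_act_surj A B (Z : garside_szep A B l) g h :
  A g -> B h -> exists g0 h', [/\ A g0, B h' & h * g0 = g * h'].
Proof.
have S := gs_szep Z; move: g h.
apply: (atom_ind (gs_lenM Z) (gs_len0 Z)) => [|a g ata IHg] h Ag Bh.
  by exists 1, h; rewrite mulg1 mul1g; split=> //; apply: szep_1l S.
have [Aa {}Ag] := szep_factor S Ag.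
have [b [h1 [Ab _ Bh1 eq1]]] := szep_act_atom_surj Z Aa ata Bh.
have [g0 [h2 [Ag0 Bh2 eq2]]] := IHg h1 Ag Bh1.
exists (b * g0), h2; split=> //; first exact: (szep_Ml S).
by rewrite mulgA eq1 -!mulgA eq2.
Qed.

(** * Least common multiples in the product *)

Lemma is_lcm_sym (le : M -> M -> Prop) x y z :
  is_lcm le x y z -> is_lcm le y x z.
Proof. by case=> xz yz minz; split=> // t yt xt; apply: minz. Qed.

(** Two lcm squares are pasted along [u], the complement of [x] in its lcm with [y]. This lets lcms
    be computed factor by factor. *)
Lemma is_lcm_mul (mI : right_injective (@mul M)) (x y z u w : M) :
  is_lcm (@prefix_of M) x y (x * u) -> is_lcm (@prefix_of M) z u w ->
  is_lcm (@prefix_of M) (x * z) y (x * w).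
Proof.
move=> [_ yxu minxu] [[z' defw] [u' defw'] minw]; split.
- by exists z'; rewrite -mulgA -defw.
- by apply: (prefix_of_trans yxu); exists u'; rewrite -mulgA -defw'.
- move=> t [t1 deft] yt.
  have [s eqs] : prefix_of (x * u) t.
    by apply: minxu => //; exists (z * t1); rewrite mulgA.
  have eq1 : z * t1 = u * s by apply: (mI x); rewrite !mulgA -deft.
  have [v defv] : prefix_of w (z * t1).
    by apply: minw; [exists t1 | exists s].
  by exists v; rewrite deft -!mulgA defv.
Qed.

Lemma szep_lcm_lr A B (Z : garside_szep A B l) g h :
  A g -> B h -> exists z, is_lcm (@prefix_of M) g h z.
Proof.
move=> Ag Bh; have S := gs_szep Z.
have [g0 [b0 [Ag0 Bb0 eq0]]] := szep_act_surj Z Ag Bh.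
(* The lcm is [h * g0], where [g0] is the preimage of [g] under the action of [h]. *)
exists (h * g0); split; [by exists b0 | exact: prefix_of_mulr |].
move=> t [k' deft] [k defth].
have [g1 [h1 [Ag1 Bh1 defk]]] := szep_lr S k.
have [g1' [h1' [Ag1' Bh1' eq1]]] := szep_lr S (h * g1).
have [g2 [h2 [Ag2 Bh2 defk']]] := szep_lr S k'.
have [eqg _] : g * g2 = g1' /\ h2 = h1' * h1.
  apply: (szep_inj_lr S) => //; [exact: (szep_Ml S)
                                |exact: (szep_Mr S) |].
  by rewrite -mulgA -defk' -deft defth defk !mulgA eq1.
(* Pulling [g2] back across [b0] gives [g0 * g3] the same image under [h] as [g1], so injectivity
   identifies them. *)
have [g3 [b1 [Ag3 Bb1 eq3]]] := szep_act_surj Z Ag2 Bb0.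
have eq4 : g0 * g3 = g1.
  apply: (szep_act_inj Z (szep_Ml S Ag0 Ag3) Ag1 Ag1' Bh Bb1 Bh1' _ eq1).
  by rewrite mulgA eq0 -mulgA eq3 mulgA eqg.
by exists (g3 * h1); rewrite defth defk -eq4 !mulgA.
Qed.

Lemma szep_lcm_l A B (Z : garside_szep A B l) g k :
  A g -> exists z, is_lcm (@prefix_of M) g k z.
Proof.
move=> Ag; have S := gs_szep Z.
have [g1 [h1 [Ag1 Bh1 ->]]] := szep_lr S k.
have [m Am lcm1] := gs_lcml Z Ag1 Ag.
have [[u defm] _ _] := lcm1.
have [_ Au] : A g1 /\ A u by apply: (szep_factor S); rewrite -defm.
have [w lcm2] := szep_lcm_lr Z Au Bh1.
exists (g1 * w); apply: is_lcm_sym; apply: is_lcm_mul (is_lcm_sym lcm2).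
  exact: gs_mulI Z.
by rewrite -defm.
Qed.

Lemma szep_lcm A B (Z : garside_szep A B l) x y :
  exists z, is_lcm (@prefix_of M) x y z.
Proof.
have [g [h [Ag Bh ->]]] := szep_lr (gs_szep Z) x.
have [m lcm1] := szep_lcm_l Z y Ag.
have [[u defm] _ _] := lcm1.
have [w lcm2] := szep_lcm_l (gs_sym Z) u Bh.
exists (g * w); apply: is_lcm_mul lcm2; first exact: gs_mulI Z.
by rewrite -defm.
Qed.

(* A Garside element is quasi-central: if [d = a * s] then the suffix [s] is a
   prefix, [d = s * t], and [a * d = d * t]. *)
Lemma gar_comm A B (Z : garside_szep A B l) d g :
  gar A d -> A g -> exists2 g', A g' & g * d = d * g'.
Proof.
have S := gs_szep Z; move=> [Ad bal _ atd]; move: g.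
apply: (atom_ind (gs_lenM Z) (gs_len0 Z)) => [|a g ata IHg] Ag.
  by exists 1; [exact: (szep_1l S) | rewrite mulg1 mul1g].
have [Aa {}Ag] := szep_factor S Ag.
have [s defs] := atd a Aa ata.
have /bal[t deft] : suffix_of s d by exists a.
have [g' Ag' eqg] := IHg Ag.
have [_ At] : A s /\ A t by apply: (szep_factor S); rewrite -deft.
exists (t * g'); first exact: (szep_Ml S).
by rewrite -mulgA eqg {1}deft !mulgA -defs.
Qed.

(** * Minimal Garside elements of a factor *)

Lemma quasi_central_suffix (mI : right_injective (@mul M)) (d y : M) :
  (forall k, prefix_of d (k * d)) -> suffix_of y d -> prefix_of y d.
Proof.
(* From [d = x * y] and [x * d = d * z], cancelling [x] leaves [d = y * z]. *)
move=> qc [x defd]; have [z eqz] := qc x.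
by exists z; apply: (mI x); rewrite eqz {1}defd !mulgA.
Qed.

(* The gcd [F] of the ideal [K d K] divides [d], is a multiple of the atoms of
   [A], and satisfies [F <= k F] for all [k]; so it is again a Garside element
   and equals [d] by minimality. *)
Lemma min_gar_prefix A B (Z : garside_szep A B l) d :
  gar A d -> (forall d', gar A d' -> (l d <= l d')%N) ->
  forall k, prefix_of d (k * d).
Proof.
move=> gd mind; have S := gs_szep Z; have mI := gs_mulI Z.
have gcd := gcd_ex (gs_lenM Z) (gs_len0 Z) (szep_lcm Z).
pose I := [set x : M | exists k k', x = k * d * k'].
have Id : I d by exists 1, 1; rewrite mul1g mulg1.
have [F FI maxF] := gcd I d Id.
(* The gcd [w] of [k I] has the form [k * w'] with [w'] dividing [F]; since [k I] lies in [I], [F]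
   divides [w], hence [k * F]. *)
have qcF k : prefix_of F (k * F).
  have Ikd : [set k * x | x in I] (k * d) by exists d.
  have [w wI maxw] := gcd _ _ Ikd.
  have [w' defw] : prefix_of k w by apply: maxw => _ [x _ <-]; exists x.
  have w'F : prefix_of w' F.
    apply: maxF => x Ix; have [|v eqv] := wI (k * x); first by exists x.
    by exists v; apply: (mI k); rewrite eqv defw mulgA.
  have Fw : prefix_of F w.
    apply: maxw => _ [x [k1 [k2 ->]] <-]; apply: FI.
    by exists (k * k1), k2; rewrite !mulgA.
  have [v eqv] := w'F.
  by apply: (prefix_of_trans Fw); exists v; rewrite eqv defw mulgA.
have Fd := FI d Id; have [Ad bald find atd] := gd.
have AF := szep_prefix S Ad Fd.
(* For [k = h * g], first move [g] past [d]; then [h * d] starts with [h * b], where [b] is the atom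
   sent to [a] by [h]. *)
have atF a : A a -> atom a -> prefix_of a F.
  move=> Aa ata; apply: maxF => _ [k [k' ->]].
  have [h [g [Bh Ag ->]]] := szep_rl S k.
  have [g' _ eqg] := gar_comm Z gd Ag.
  have [b [h1 [Ab atb Bh1 eqb]]] := szep_act_atom_surj Z Aa ata Bh.
  have [s defs] := atd b Ab atb.
  exists (h1 * s * g' * k').
  by rewrite -(mulgA h) eqg defs !mulgA eqb.
have finF : finite_set (Div F).
  by apply: sub_finite_set find => x; move/prefix_of_trans; apply.
have sufF x : suffix_of x F -> prefix_of x F by apply: quasi_central_suffix.
(* Sending [x] to [z] when [F = x * z] is an injective self-map of the finite set [Div F], by [sufF]
   and cancellation, hence onto. *)
have preF y : prefix_of y F -> suffix_of y F.
  move=> yF; pose r (x y : M) := F = x * y.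
  have tot x : Div F x -> exists2 z, Div F z & r x z.
    by move=> [z defF]; exists z => //; apply: sufF; exists x.
  have inj x x' z : Div F x -> Div F x' -> Div F z -> r x z -> r x' z -> x = x'.
    by move=> _ _ _ rx rx'; apply: (gs_mulIm Z (x := z)); rewrite -rx -rx'.
  by have [x _ rxy] := finite_inj_surj finF tot inj yF; exists x.
have gF : gar A F by split=> // x; split; [apply: preF | apply: sufF].
by rewrite -(prefix_len_eq (gs_lenM Z) (gs_len0 Z) Fd (mind F gF)).
Qed.

Lemma min_gar_ex A B (Z : garside_szep A B l) :
  exists2 d, gar A d & forall d', gar A d' -> (l d <= l d')%N.
Proof.
have [d gd] := gs_garl Z.
have ex : exists n, exists2 d, gar A d & l d = n by exists (l d), d.
have [_ [d0 gd0 <-] mind] := ex_min_nat ex.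
by exists d0 => // d' gd'; apply: mind; exists d'.
Qed.

End GarsideSzep.

Lemma min_gar_suffix (M : monoidType) (l : M -> nat) (A B : set M) (d : M) :
  garside_szep A B l ->
  gar A d -> (forall d', gar A d' -> (l d <= l d')%N) ->
  forall k, suffix_of d (d * k).
Proof.
move=> Z gd mind k.
have /gar_converse gd' := gd.
by apply: (min_gar_prefix (gs_converse Z) gd') => d' /gar_converse/mind.
Qed.

(** * The product of the two minimal Garside elements *)

Lemma garside_szep_garside (M : monoidType) (A B : set M) (l : M -> nat) :
  garside_szep A B l -> garside_monoid M.
Proof.
move=> Z; have S := gs_szep Z.
have [dA gA minA] := min_gar_ex Z.
have [dB gB minB] := min_gar_ex (gs_sym Z).
have preA := min_gar_prefix Z gA minA.
have preB := min_gar_prefix (gs_sym Z) gB minB.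
have sufA := min_gar_suffix Z gA minA.
have sufB := min_gar_suffix (gs_sym Z) gB minB.
pose D := dA * dB.
have preD k : prefix_of D (k * D).
  have [u equ] := preA k; have [v eqv] := preB u.
  by exists v; rewrite /D mulgA equ -mulgA eqv mulgA.
have sufD k : suffix_of D (D * k).
  have [u equ] := sufB k; have [v eqv] := sufA u.
  by exists v; rewrite /D -mulgA equ mulgA eqv mulgA.
have suf_pre x : suffix_of x D -> prefix_of x D.
  by apply: quasi_central_suffix preD => ? ? ?; apply: (gs_mulI Z).
have pre_suf x : prefix_of x D -> suffix_of x D.
  have mI := gs_mulI (gs_converse Z).
  exact: (@quasi_central_suffix (converse M) mI D x sufD).
exists D; split.
- split; first by split=> ? ? ?; [apply: (gs_mulI Z) | apply: (gs_mulIm Z)].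
  exact: len_atomic (gs_lenM Z) (gs_len0 Z).
- split; first exact: prefix_lattice (gs_lenM Z) (gs_len0 Z) (szep_lcm Z).
  have Zc := gs_converse Z.
  exact: (prefix_lattice (gs_lenM Zc) (gs_len0 Zc) (szep_lcm Zc)).
- by apply/seteqP; split.
- move=> x; have [s [sA prods]] := (len_atomic (gs_lenM Z) (gs_len0 Z)).1 x.
  exists s; split=> // a /sA ata.
  (* An atom lies in [A] or in [B], so it divides [dA], which starts [D], or is a suffix of [dB],
     which ends [D]. *)
  have [g [h [Ag Bh eqa]]] := szep_lr S a.
  have [eq1|eq1] := ata.2 g h eqa.
    rewrite eq1 mul1g in eqa; apply: suf_pre.
    have /(gar_balanced gB)[u equ] : prefix_of a dB.
      by apply: (gar_atom gB) => //; rewrite eqa.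
    by exists (dA * u); rewrite /D equ mulgA.
  rewrite eq1 mulg1 in eqa.
  have [u equ] : prefix_of a dA by apply: (gar_atom gA) => //; rewrite eqa.
  by exists (u * dB); rewrite /D equ mulgA.
(* By uniqueness of decompositions, a divisor [g * h] of [D] has [g] a prefix of [dA] and [h] a
   suffix of [dB], so there are finitely many. *)
- apply: sub_finite_set
    (finite_image2 (@mul M) (gar_fin gA) (gar_fin gB)) => x xD.
  have [g [h [Ag Bh defx]]] := szep_lr S x.
  exists g; [|exists h => //].
    have [u eqD] := xD; have [g' [h' [Ag' Bh' equ]]] := szep_lr S (h * u).
    have [eqg _] : dA = g * g' /\ dB = h'.
      apply: (szep_inj_lr S) => //.
      - exact: gar_in gA.
      - exact: gar_in gB.
      - exact: (szep_Ml S).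
      - by rewrite -mulgA -equ mulgA -defx -eqD.
    by exists g'.
  have [u eqD] := pre_suf x xD.
  have [g' [h' [Ag' Bh' equ]]] := szep_lr S (u * g).
  have [_ eqh] : dA = g' /\ dB = h' * h.
    apply: (szep_inj_lr S) => //.
    - exact: gar_in gA.
    - exact: gar_in gB.
    - exact: (szep_Mr S).
    - by rewrite mulgA -equ -mulgA -defx -eqD.
  by apply/(gar_balanced gB); exists h'.
Qed.

(** * Chains of nontrivial factors and the length function *)

Inductive chain (M : monoidType) (A : set M) : nat -> M -> Prop :=
| chain0 : chain A 0 1
| chainS n x y : A x -> x <> 1 -> chain A n y -> chain A n.+1 (x * y).

Lemma chain_cat (M : monoidType) (A : set M) m n x y :
  chain A m x -> chain A n y -> chain A (m + n) (x * y).
Proof.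
move=> + cy; elim=> [|p z t Az z1 _ IH]; rewrite ?mul1g // -mulgA.
exact: chainS.
Qed.

Lemma chain1 (M : monoidType) (A : set M) x : A x -> x <> 1 -> chain A 1 x.
Proof.
by move=> Ax x1; rewrite -(mulg1 x); apply: chainS => //; apply: chain0.
Qed.

Lemma chain_converse (M : monoidType) (A : set M) n x :
  @chain (converse M) A n x <-> chain A n x.
Proof.
split; elim=> [|p z t Az z1 _ IH]; try exact: chain0.
  by rewrite -addn1; apply: (chain_cat IH); apply: chain1.
by rewrite -addn1; apply: (@chain_cat (converse M) A _ _ t z IH); apply: chain1.
Qed.

(** The factors cross [h] one by one; a factor with trivial image would be trivial by uniqueness
    with [B] first. *)
Lemma chain_swap (M : monoidType) (A B : set M) (S : szep A B) n g g' h h' :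
  A g -> B h -> A g' -> B h' -> h * g = g' * h' -> chain A n g -> chain A n g'.
Proof.
move=> + + + + + c.
elim: c g' h h' => [|p x y Ax x1 _ IH] g' h h' Axy Bh Ag' Bh' eq.
  rewrite mulg1 -(mul1g h) in eq.
  have [<- _] := szep_inj_lr S (szep_1l S) Bh Ag' Bh' eq; exact: chain0.
have [_ Ay] := szep_factor S Axy.
have [x' [h1 [Ax' Bh1 eqx]]] := szep_lr S (h * x).
have [y' [h2 [Ay' Bh2 eqy]]] := szep_lr S (h1 * y).
have [<- _] : x' * y' = g' /\ h2 = h'.
  apply: (szep_inj_lr S) => //; first exact: (szep_Ml S).
  by rewrite -eq -mulgA -eqy !mulgA eqx.
apply: chainS (IH _ _ _ Ay Bh1 Ay' Bh2 eqy) => // x'1.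
rewrite x'1 mul1g -(mulg1 h1) in eqx.
by have [_ /x1] := szep_inj_rl S Bh Ax Bh1 (szep_1l S) eqx.
Qed.

Lemma chain_swapE (M : monoidType) (A B : set M) (S : szep A B) n g g' h h' :
  A g -> B h -> A g' -> B h' -> h * g = g' * h' -> chain A n g <-> chain A n g'.
Proof.
move=> Ag Bh Ag' Bh' eq; split; first exact: (chain_swap S) eq.
move=> /chain_converse c; apply/chain_converse.
exact: (chain_swap (szep_converse S) Ag' Bh' Ag Bh (esym eq)).
Qed.

Definition noetherian (M : monoidType) (A : set M) : Prop :=
  forall x, A x -> exists N, forall n, chain A n x -> (n <= N)%N.

Definition max_chain (M : monoidType) (A : set M) n x : Prop :=
  chain A n x /\ forall m, chain A m x -> (m <= n)%N.

Lemma max_chain_ex (M : monoidType) (A : set M) x :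
  noetherian A -> A x -> exists n, max_chain A n x.
Proof.
move=> noeA Ax; have [N boundN] := noeA x Ax.
have ex : exists n, chain A n x.
  case: (lem (x = 1)) => [->|x1]; first by exists 0%N; apply: chain0.
  by exists 1%N; apply: chain1.
by have [n cn maxn] := ex_max_nat ex boundN; exists n.
Qed.

Lemma max_chain_inj (M : monoidType) (A : set M) m n x :
  max_chain A m x -> max_chain A n x -> m = n.
Proof.
by move=> [cm maxm] [cn maxn]; apply/eqP; rewrite eqn_leq maxn ?maxm.
Qed.

Lemma max_chain_1 (M : monoidType) (A : set M) n : max_chain A n 1 -> n = 0%N.
Proof.
by move=> [cn maxn]; have := chain_cat cn cn; rewrite mulg1 => /maxn; lia.
Qed.

(** The length of [g * h] is the sum of the maximal chain lengths of [g] in [A] and of [h] in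
    [B]. *)
Lemma length_ex (M : monoidType) (A B : set M) :
  szep A B -> noetherian A -> noetherian B ->
  exists l : M -> nat,
  [/\ forall x y, (l x + l y <= l (x * y)%g)%N,
      forall x, l x = 0%N -> x = 1,
      forall a b a' b', A a -> B b -> A a' -> B b' ->
        a * b = b' * a' -> l a = l a' &
      forall a b a' b', A a -> B b -> A a' -> B b' ->
        a * b = b' * a' -> l b = l b'].
Proof.
move=> S noeA noeB; have S' := szep_sym S.
pose P k n := exists g h p q, [/\ A g, B h, k = g * h &
  [/\ max_chain A p g, max_chain B q h & n = (p + q)%N]].
have /choice[l lP] k : exists n, P k n.
  have [g [h [Ag Bh eqk]]] := szep_lr S k.
  have [p maxp] := max_chain_ex noeA Ag; have [q maxq] := max_chain_ex noeB Bh.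
  by exists (p + q)%N, g, h, p, q.
have lE g h p q : A g -> B h -> max_chain A p g -> max_chain B q h ->
    l (g * h) = (p + q)%N.
  move=> Ag Bh maxp maxq.
  have [g' [h' [p' [q' [Ag' Bh' eq [maxp' maxq' ->]]]]]] := lP (g * h).
  have [eqg eqh] := szep_inj_lr S Ag Bh Ag' Bh' eq.
  rewrite -eqg in maxp'; rewrite -eqh in maxq'.
  by rewrite (max_chain_inj maxp maxp') (max_chain_inj maxq maxq').
have [oA maxA1] := max_chain_ex noeA (szep_1l S).
have [oB maxB1] := max_chain_ex noeB (szep_1r S).
have lA a p : A a -> max_chain A p a -> l a = p.
  move=> Aa maxp; rewrite -(mulg1 a) (lE _ _ p oB) //; last exact: szep_1r S.
  by rewrite (max_chain_1 maxB1) addn0.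
have lB b q : B b -> max_chain B q b -> l b = q.
  move=> Bb maxq; rewrite -(mul1g b) (lE _ _ oA q) //; last exact: szep_1l S.
  by rewrite (max_chain_1 maxA1).
exists l; split.
- move=> x y.
  have [g [h [p [q [Ag Bh eqx [maxp maxq ->]]]]]] := lP x.
  have [g' [h' [p' [q' [Ag' Bh' eqy [maxp' maxq' ->]]]]]] := lP y.
  have [g2 [h2 [Ag2 Bh2 eq2]]] := szep_lr S (h * g').
  have Agg := szep_Ml S Ag Ag2; have Bhh := szep_Mr S Bh2 Bh'.
  have [P1 maxP1] := max_chain_ex noeA Agg.
  have [Q1 maxQ1] := max_chain_ex noeB Bhh.
  (* Swapping the inner factors [h] and [g'] preserves their chains, which then concatenate with
     those of [g] and [h']. *)
  have -> : x * y = (g * g2) * (h2 * h').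
    by rewrite eqx eqy -!mulgA (mulgA h) eq2 !mulgA.
  rewrite (lE _ _ _ _ Agg Bhh maxP1 maxQ1).
  have le1 : (p + p' <= P1)%N.
    apply: maxP1.2; apply: chain_cat maxp.1 _.
    exact/(chain_swapE S _ Ag' Bh Ag2 Bh2 eq2)/maxp'.1.
  have le2 : (q + q' <= Q1)%N.
    apply: maxQ1.2; apply: chain_cat maxq'.1.
    exact/(chain_swapE S' _ Bh2 Ag2 Bh Ag' (esym eq2))/maxq.1.
  by lia.
- move=> x lx0; have [g [h [p [q [Ag Bh eqx [maxp maxq lx]]]]]] := lP x.
  have g1 : g = 1.
    by apply: contrapT => g1; have := maxp.2 _ (chain1 Ag g1); lia.
  have h1 : h = 1.
    by apply: contrapT => h1; have := maxq.2 _ (chain1 Bh h1); lia.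
  by rewrite eqx g1 h1 mulg1.
- move=> a b a' b' Aa Bb Aa' Bb' eq.
  have [p [cp maxp]] := max_chain_ex noeA Aa.
  rewrite (lA a p) // (lA a' p) //.
  have E n := chain_swapE S n Aa' Bb' Aa Bb (esym eq).
  by split; [apply/E | move=> m /E/maxp].
- move=> a b a' b' Aa Bb Aa' Bb' eq.
  have [p [cp maxp]] := max_chain_ex noeB Bb.
  rewrite (lB b p) // (lB b' p) //.
  have E n := chain_swapE S' n Bb Aa Bb' Aa' eq.
  by split; [apply/E | move=> m /E/maxp].
Qed.

(** * Cancellation and lcms inherited from the factors *)

Lemma szep_mulI (M : monoidType) (A B : set M) (S : szep A B) :
  (forall x y z, A x -> A y -> A z -> x * y = x * z -> y = z) ->
  (forall x y z, B x -> B y -> B z -> x * y = x * z -> y = z) ->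
  right_injective (@mul M).
Proof.
move=> cA cB k x y eqk.
have [g [h [Ag Bh defk]]] := szep_lr S k.
(* Comparing decompositions with [A] first cancels [g]; those with [B] first then cancel [h]. *)
have {eqk} : h * x = h * y.
  have [a [b [Aa Bb eqx]]] := szep_lr S (h * x).
  have [a' [b' [Aa' Bb' eqy]]] := szep_lr S (h * y).
  have [eqa eqb] : g * a = g * a' /\ b = b'.
    apply: (szep_inj_lr S) => //; try exact: (szep_Ml S).
    by rewrite -!mulgA -eqx -eqy !mulgA -defk.
  by rewrite eqx eqy eqb (cA _ _ _ Ag Aa Aa' eqa).
have [b [a [Bb Aa ->]]] := szep_rl S x.
have [b' [a' [Bb' Aa' ->]]] := szep_rl S y.
rewrite !mulgA => eqh.
have [eqb ->] := szep_inj_rl S (szep_Mr S Bh Bb) Aa (szep_Mr S Bh Bb') Aa' eqh.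
by rewrite (cB _ _ _ Bh Bb Bb' eqb).
Qed.

(** Divisors in [A] of [a * b] already divide its [A]-part [a], so testing against multiples in [A]
    suffices. *)
Lemma szep_lcm_extend (M : monoidType) (A B : set M) (S : szep A B) x y z :
  A x -> A y -> prefix_of x z -> prefix_of y z ->
  (forall t, A t -> prefix_of x t -> prefix_of y t -> prefix_of z t) ->
  is_lcm (@prefix_of M) x y z.
Proof.
move=> Ax Ay xz yz minz; split=> // t.
have [a [b [Aa Bb ->]]] := szep_lr S t.
have part w : A w -> prefix_of w (a * b) -> prefix_of w a.
  move=> Aw [u equ]; have [a1 [b1 [Aa1 Bb1 eq1]]] := szep_lr S u.
  have [-> _] : a = w * a1 /\ b = b1; last by exists a1.
  by apply: (szep_inj_lr S) => //; [exact: (szep_Ml S) | rewrite equ eq1 mulgA].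
move=> /(part x Ax) xa /(part y Ay) ya.
by apply: (prefix_of_trans (minz a Aa xa ya)); exists b.
Qed.

(** * Transfer from submonoid types to subsets *)

Section Submonoid.
Variables (K : monoidType) (PG : pred K) (G : subMonoidType PG).
Notation A := [set x | PG x].
Notation val := (val : G -> K).

Lemma val_surj (x : K) : A x -> exists g : G, val g = x.
Proof. by move=> Ax; exists (Sub x Ax); rewrite SubK. Qed.

Lemma val_eq1 (g : G) : val g = 1 -> g = 1.
Proof. by move=> eq; apply: val_inj; rewrite val1. Qed.

Lemma garside_unit x y : garside_monoid G -> A x -> A y -> x * y = 1 -> x = 1.
Proof.
move=> [d [_ [[[_ _ anti] _ _] _] _ _ _]] /val_surj[g <-] /val_surj[h <-] eq.
have gh1 : g * h = 1 by apply: val_eq1; rewrite valM.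
rewrite (anti g 1) ?val1 //; first by exists h.
by exists g; rewrite mul1g.
Qed.

Lemma garside_cancell x y z : garside_monoid G ->
  A x -> A y -> A z -> x * y = x * z -> y = z.
Proof.
move=> [d [[[mI _] _] _ _ _ _]] /val_surj[g <-] /val_surj[h <-] /val_surj[k <-].
by rewrite -!valM => /val_inj/mI ->.
Qed.

Lemma garside_cancelr x y z : garside_monoid G ->
  A x -> A y -> A z -> y * x = z * x -> y = z.
Proof.
move=> [d [[[_ mI] _] _ _ _ _]] /val_surj[g <-] /val_surj[h <-] /val_surj[k <-].
by rewrite -!valM => /val_inj/mI ->.
Qed.

(** Each nontrivial factor of a chain expands to a nonempty word in atoms, so the atomic bound also
    bounds chains. *)
Lemma garside_noetherian : garside_monoid G -> noetherian A.
Proof.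
move=> [d [[_ [gen bound]] _ _ _ _]] _ /val_surj[g <-].
have [N boundN] := bound g; exists N => n c.
suff [s [sA prods]] : exists s : seq G, [/\ forall a, a \in s -> atom a,
    val (\prod_(a <- s) a) = val g & (n <= size s)%N].
  move=> le; apply: leq_trans le _; apply: boundN.
  by split=> //; apply: val_inj.
elim: c => [|p x y /val_surj[h <-] h1 _ [s [sA <- les]]].
  by exists [::]; rewrite big_nil val1.
have [t [tA prodt]] := gen h.
exists (t ++ s); rewrite big_cat /= valM prodt size_cat; split=> //.
  by move=> a; rewrite mem_cat => /orP[/tA|/sA].
case: t prodt {tA} => [|a t] /=; last by move=> _; lia.
by rewrite big_nil => eq1; case: h1; rewrite -eq1 val1.
Qed.

Variables (B : set K).
Hypothesis S : szep A B.

Lemma prefix_val (g h : G) : prefix_of (val g) (val h) <-> prefix_of g h.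
Proof.
split=> [[u eqh]|[u ->]]; last by exists (val u); rewrite valM.
have [_ /val_surj[v defv]] : A (val g) /\ A u.
  by apply: (szep_factor S); rewrite -eqh; apply: valP.
by exists v; apply: val_inj; rewrite valM defv.
Qed.

Lemma suffix_val (g h : G) : suffix_of (val g) (val h) <-> suffix_of g h.
Proof.
split=> [[u eqh]|[u ->]]; last by exists (val u); rewrite valM.
have [/val_surj[v defv] _] : A u /\ A (val g).
  by apply: (szep_factor S); rewrite -eqh; apply: valP.
by exists v; apply: val_inj; rewrite valM defv.
Qed.

Lemma garside_lcm x y : garside_monoid G -> A x -> A y ->
  exists2 z, A z & is_lcm (@prefix_of K) x y z.
Proof.
move=> [d [_ [[_ lcm _] _] _ _ _]] Ax Ay.
have [g eqg] := val_surj Ax; have [h eqh] := val_surj Ay.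
have [k [gk hk mink]] := lcm g h; exists (val k); first exact: valP.
apply: (szep_lcm_extend S) => //; try by rewrite -?eqg -?eqh; apply/prefix_val.
move=> _ /val_surj[t <-]; rewrite -eqg -eqh => /prefix_val gt /prefix_val ht.
by apply/prefix_val/mink.
Qed.

Lemma garside_suffix_lcm x y : garside_monoid G -> A x -> A y ->
  exists2 z, A z & is_lcm (@suffix_of K) x y z.
Proof.
move=> [d [_ [_ [_ lcm _]] _ _ _]] Ax Ay.
have [g eqg] := val_surj Ax; have [h eqh] := val_surj Ay.
have [k [gk hk mink]] := lcm g h; exists (val k); first exact: valP.
apply: (szep_lcm_extend (szep_converse S)) => //;
  try by rewrite -?eqg -?eqh; apply/suffix_val.
move=> _ /val_surj[t <-]; rewrite -eqg -eqh => /suffix_val gt /suffix_val ht.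
by apply/suffix_val/mink.
Qed.

Lemma garside_gar : garside_monoid G -> exists d, gar A d.
Proof.
move=> [d [_ _ /seteqP[pre suf] gen fin]]; exists (val d); split.
- exact: valP.
- move=> x; split=> xd.
    have /val_surj[g eqg] := szep_prefix S (valP d) xd.
    by rewrite -eqg in xd *; apply/suffix_val/pre/prefix_val.
  have [/= u eqd] := xd; have [_ /val_surj[g eqg]] : A u /\ A x.
    by apply: (szep_factor S); rewrite -eqd; apply: valP.
  by rewrite -eqg in xd *; apply/prefix_val/suf/suffix_val.
- apply: sub_finite_set (finite_image val fin) => x xd.
  have /val_surj[g eqg] := szep_prefix S (valP d) xd.
  by exists g => //; apply/prefix_val; rewrite eqg.
- move=> _ /val_surj[a <-] [a1 aP]; apply/prefix_val/(atom_generator gen).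
  split=> [eq1|u v equv]; first by apply: a1; rewrite eq1 val1.
  have [|eq1|eq1] := aP (val u) (val v); first by rewrite equv valM.
    by left; apply: val_eq1.
  by right; apply: val_eq1.
Qed.

End Submonoid.

(** * From the unique quadruples to decompositions by subsets, and the conclusion *)

Lemma zappa_szep_szep (K : monoidType) (PG PH : pred K)
    (G : subMonoidType PG) (H : subMonoidType PH) :
  zappa_szep G H -> garside_monoid G -> garside_monoid H ->
  szep [set x | PG x] [set x | PH x].
Proof.
move=> ZS gG gH; split.
- by rewrite /= -(val1 G); apply: valP.
- by rewrite /= -(val1 H); apply: valP.
- move=> _ _ /(val_surj G)[g <-] /(val_surj G)[g' <-].
  by rewrite -valM; apply: valP.
- move=> _ _ /(val_surj H)[h <-] /(val_surj H)[h' <-].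
  by rewrite -valM; apply: valP.
- move=> k; have [[[[g1 g2] h1] h2] [[<- _] _]] := ZS k.
  by exists (val g1), (val h1); split=> //; apply: valP.
- move=> k; have [[[[g1 g2] h1] h2] [[_ ->] _]] := ZS k.
  by exists (val h2), (val g2); split=> //; apply: valP.
- move=> a b a' b' /(val_surj G)[g <-] /(val_surj H)[h <-].
  move=> /(val_surj G)[g' <-] /(val_surj H)[h' <-] eq.
  (* Uniqueness concerns whole quadruples, so both decompositions are completed by the same pair
     [g2], [h2] from the other side. *)
  have [[[[g1 g2] h1] h2] [[_ eqk] uniq]] := ZS (val g * val h).
  have := uniq (g', g2, h', h2) (conj (esym eq) eqk).
  by rewrite (uniq (g, g2, h, h2) (conj erefl eqk)) => -[-> ->].
- move=> b a b' a' /(val_surj H)[h <-] /(val_surj G)[g <-].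
  move=> /(val_surj H)[h' <-] /(val_surj G)[g' <-] eq.
  have [[[[g1 g2] h1] h2] [[eqk _] uniq]] := ZS (val h * val g).
  have := uniq (g1, g', h1, h') (conj eqk eq).
  by rewrite (uniq (g1, g, h1, h) (conj eqk erefl)) => -[-> ->].
- by move=> x y; apply: (garside_unit gG).
- by move=> x y; apply: (garside_unit gH).
Qed.

Theorem theorem37 (K : monoidType) (PG PH : pred K)
    (G : subMonoidType PG) (H : subMonoidType PH) :
  zappa_szep G H -> garside_monoid G -> garside_monoid H -> garside_monoid K.
Proof.
move=> ZS gG gH; have S := zappa_szep_szep ZS gG gH; have S' := szep_sym S.
have [l [lenM len0 lenl lenr]] :=
  length_ex S (garside_noetherian gG) (garside_noetherian gH).
apply: (@garside_szep_garside K [set x | PG x] [set x | PH x] l); split=> //.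
- apply: (szep_mulI S) => x y z; [exact: (garside_cancell gG)
                                 |exact: (garside_cancell gH)].
- move=> x; apply: (szep_mulI (szep_converse S)) => {}x y z;
    [exact: (garside_cancelr gG) | exact: (garside_cancelr gH)].
- by move=> x y; apply: (garside_lcm S gG).
- by move=> x y; apply: (garside_lcm S' gH).
- by move=> x y; apply: (garside_suffix_lcm S gG).
- by move=> x y; apply: (garside_suffix_lcm S' gH).
- exact: (garside_gar S gG).
- exact: (garside_gar S' gH).
Qed.
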